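(* Let $A\in\mathbb{R}^{n\times n}$ be nonsingular with $\kappa=\operatorname{cond}(A)$, let $b\in\mathbb{R}^n$, and let $x=A^{-1}b$. Assume that $A$ is numerically full rank, $\kappa u\ll 1$, and that $P\in\mathbb{R}^{n\times n}$ is a high-quality preconditioner, $\operatorname{cond}(AP^{-1})\le C$ for an absolute constant $C$, scaled so that $\|AP^{-1}\|\asymp 1$. Assume that the operations $Az$, $A^\top z$, $P^{-1}z$, $P^{-\top}z$ are performed in a backward stable way. Run the following meta-solver in floating point arithmetic with unit roundoff $u$: set $x_0=0$ and, for $i=0,1,\dots,t-1$, (a) $c_i\leftarrow P^{-\top}(A^\top(b-Ax_i))$; (b) $\delta y_i\leftarrow$ output of a subroutine IterativeSolver applied to the linear system $(P^{-\top}A^\top A P^{-1})\,\delta y_i=c_i$, where the matrix is accessed through $z\mapsto P^{-\top}(A^\top(A(P^{-1}z)))$; (c) $x_{i+1}\leftarrow x_i+P^{-1}\delta y_i$. Let $\hat x_i$ denote the computed iterates. Assume that the IterativeSolver subroutine, called with right-hand side $c_i$, produces an output $\widehat{\delta y}_i$ satisfying $$\big\|\widehat{\delta y}_i-(P^{-\top}A^\top A P^{-1})^{-1}c_i\big\|\lesssim \kappa u\,\|c_i\|.$$ Then there is a $c\lesssim 1$ such that the computed iterates satisfy $$\frac{\|b-A\hat x_i\|}{\|A\|\,\|x\|}\lesssim u+(c\kappa u)^i .$$ In particular, $t=\mathcal{O}\big(\log(1/u)/\log(1/(\kappa u))\big)$ iterative refinement steps suffice to attain a backward stable solution, i.e.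 a computed $\hat x_t$ satisfying $(A+\Delta A)\hat x_t=b$ for some $\Delta A$ with $\|\Delta A\|\lesssim u\|A\|$.
   Context: Norms: $\|\cdot\|$ is the Euclidean norm of vectors and the spectral norm of matrices; $\operatorname{cond}(B)=\sigma_{\max}(B)/\sigma_{\min}(B)$. Floating point: computations follow the standard model of floating point arithmetic with unit roundoff $u$ (each basic operation incurs relative error at most $u$; no overflow or underflow). A hat denotes, or $\operatorname{fl}(\cdot)$ gives, the computed value of an expression. A vector $z$ is exactly representable if $\operatorname{fl}(z)=z$. The right-hand side $c_i$ in the subroutine guarantee is the (floating point) vector actually passed to the subroutine. Order notation: for $a,b\ge 0$, $a\lesssim b$ means $a\le p(n,\log(1/u))\,b$ for some polynomial $p$ (not depending on the particular $A,P,b$ or on $i$, but possibly on the absolute constants such as $C$ and on the polynomials in the hypotheses). As a hypothesis, $a\ll b$ means $a\le b/p(n,\log(1/u))$ for a polynomial $p$ that may be taken as large as needed for the conclusion (i.e. there exists such a $p$ for which the conclusion holds). $a\asymp b$ means $a$ and $b$ are comparable up to absolute constants. Backward stable operations: for exactly representable $z$, $\|\operatorname{fl}(Az)-Az\|\lesssim\|A\|\|z\|u$ and $\|\operatorname{fl}(A^\top z)-A^\top z\|\lesssim\|A\|\|z\|u$; and the computed $\operatorname{fl}(P^{-1}z)$ satisfies $(P+\Delta P)\operatorname{fl}(P^{-1}z)=z$ for some $\Delta P$ (depending on $z$) with $\|\Delta P\|\lesssim\|P\|u$, and similarly for $P^{-\top}z$ with $P^\top$ in place of $P$. Backward stability of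 a linear solver: there exists a prefactor $c$, polynomially large in $n$ and $\log(1/u)$, such that whenever $c\operatorname{cond}(A)u<1$ the computed output $\hat x$ satisfies $(A+\Delta A)\hat x=b$ with $\|\Delta A\|\le cu\|A\|$. *)

(* Defs.v *)
From mathcomp Require Import all_boot all_order all_algebra polyXY.
From mathcomp Require Import boolp classical_sets reals exp.

Set Implicit Arguments.
Unset Strict Implicit.
Unset Printing Implicit Defensive.
Import Order.TTheory GRing.Theory Num.Theory.
Local Open Scope classical_set_scope.
Local Open Scope ring_scope.

Section Norms.
Variable R : realType.

(* The norm [`|z|] that MathComp-Analysis puts on matrices is the max norm,
   hence these definitions. *)
Definition enorm n (z : 'cV[R]_n) : R := Num.sqrt (\sum_i z i 0 ^+ 2).

Definition specnorm n (B : 'M[R]_n) : R :=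
  sup [set enorm (B *m z) | z in [set z : 'cV[R]_n | enorm z <= 1]].

Definition singular_values n (B : 'M[R]_n) : set R :=
  [set s | 0 <= s /\ eigenvalue (B^T *m B) (s ^+ 2)].

Definition sigma_max n (B : 'M[R]_n) : R := sup (singular_values B).

Definition sigma_min n (B : 'M[R]_n) : R := inf (singular_values B).

(* Meaningful for nonsingular [B] only: the division makes it 0 otherwise. *)
Definition cond n (B : 'M[R]_n) : R := sigma_max B / sigma_min B.

End Norms.

Section OrderNotation.
Variable R : realType.

(* Polynomials in n and log(1/u). The dependence of [p] on the problem data is
   controlled by where [p] is quantified. *)
Definition prefactor (p : {poly {poly R}}) (n : nat) (u : R) : R :=
  p.[n%:R, ln u^-1].

Definition lesssim (p : {poly {poly R}}) (n : nat) (u a b : R) : Prop :=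
  a <= prefactor p n u * b.

(* a <= b / p, multiplied out so that a polynomial [p] with nonpositive values
   yields a void condition and not an unsatisfiable one. *)
Definition muchless (p : {poly {poly R}}) (n : nat) (u a b : R) : Prop :=
  prefactor p n u * a <= b.

End OrderNotation.

Section FloatingPoint.
Variable R : realType.

(* [flop] is the computed version of [op]; operands are floating point numbers,
   i.e. fixed points of the rounding [fl], and so is the result. *)
Definition standard_model (u : R) (fl : R -> R) (op flop : R -> R -> R) : Prop :=
  forall x y, fl x = x -> fl y = y ->
    fl (flop x y) = flop x y /\ `|flop x y - op x y| <= u * `|op x y|.

(* Only addition and subtraction appear: all other scalar operations take place
   inside the products with A, A^T, P^-1, P^-T and inside the subroutine, which
   are specified by their own error bounds. Results need not be correctly
   rounded. *)
Record fp_arith := FpArith {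
  roundoff : R;
  fl : R -> R;
  fl_add : R -> R -> R;
  fl_sub : R -> R -> R;
  roundoff_gt0 : 0 < roundoff;
  roundoff_lt1 : roundoff < 1;
  fl_idem : forall x, fl (fl x) = fl x;
  fl_err : forall x, `|fl x - x| <= roundoff * `|x|;
  fl_addP : standard_model roundoff fl (fun x y => x + y) fl_add;
  fl_subP : standard_model roundoff fl (fun x y => x - y) fl_sub
}.

Definition fl_vec (fp : fp_arith) n (z : 'cV[R]_n) : 'cV[R]_n :=
  map_mx (fl fp) z.

Definition representable (fp : fp_arith) n (z : 'cV[R]_n) : Prop :=
  fl_vec fp z = z.

Definition fl_vadd (fp : fp_arith) n (y z : 'cV[R]_n) : 'cV[R]_n :=
  map2_mx (fl_add fp) y z.

Definition fl_vsub (fp : fp_arith) n (y z : 'cV[R]_n) : 'cV[R]_n :=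
  map2_mx (fl_sub fp) y z.

(* z |-> fl(A z), fl(A^T z), fl(P^-1 z), fl(P^-T z). *)
Record fl_operators n := FlOperators {
  flA : 'cV[R]_n -> 'cV[R]_n;
  flAT : 'cV[R]_n -> 'cV[R]_n;
  flPinv : 'cV[R]_n -> 'cV[R]_n;
  flPinvT : 'cV[R]_n -> 'cV[R]_n
}.

Definition stable_solve (fp : fp_arith) (p : {poly {poly R}}) n
    (B : 'M[R]_n) (f : 'cV[R]_n -> 'cV[R]_n) : Prop :=
  forall z, representable fp z ->
    representable fp (f z) /\
    exists dB : 'M[R]_n, (B + dB) *m f z = z /\
      lesssim p n (roundoff fp) (specnorm dB) (specnorm B * roundoff fp).

Record backward_stable_operators (fp : fp_arith)
    (pA pAT pP pPT : {poly {poly R}}) n (A P : 'M[R]_n)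
    (ops : fl_operators n) : Prop := BackwardStableOperators {
  stable_A : forall z, representable fp z ->
    representable fp (flA ops z) /\
    lesssim pA n (roundoff fp) (enorm (flA ops z - A *m z))
      (specnorm A * enorm z * roundoff fp);
  stable_AT : forall z, representable fp z ->
    representable fp (flAT ops z) /\
    lesssim pAT n (roundoff fp) (enorm (flAT ops z - A^T *m z))
      (specnorm A * enorm z * roundoff fp);
  stable_Pinv : stable_solve fp pP P (flPinv ops);
  stable_PinvT : stable_solve fp pPT P^T (flPinvT ops)
}.

End FloatingPoint.

Section MetaSolver.
Variables (R : realType) (fp : fp_arith R) (n : nat) (ops : fl_operators R n).

Definition normal_mx (A P : 'M[R]_n) : 'M[R]_n :=
  (invmx P)^T *m A^T *m A *m invmx P.

Definition fl_normal (z : 'cV[R]_n) : 'cV[R]_n :=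
  flPinvT ops (flAT ops (flA ops (flPinv ops z))).

(* [b] is an arbitrary real vector, rounded on input; the rounding does nothing
   if [b] is exactly representable. *)
Definition fl_rhs (b z : 'cV[R]_n) : 'cV[R]_n :=
  flPinvT ops (flAT ops (fl_vsub fp (fl_vec fp b) (flA ops z))).

(* A subroutine sees the index of the call (so that different calls may behave
   differently, as for randomized methods), the matrix-vector product and the
   right-hand side. *)
Definition subroutine : Type :=
  nat -> ('cV[R]_n -> 'cV[R]_n) -> 'cV[R]_n -> 'cV[R]_n.

Variables (IterativeSolver : subroutine) (b : 'cV[R]_n).

Fixpoint iterate (i : nat) : 'cV[R]_n :=
  if i is j.+1 then
    let xj := iterate j in
    fl_vadd fp xj (flPinv ops (IterativeSolver j fl_normal (fl_rhs b xj)))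
  else 0.

Definition call_rhs (i : nat) : 'cV[R]_n := fl_rhs b (iterate i).

Definition call_output (i : nat) : 'cV[R]_n :=
  IterativeSolver i fl_normal (call_rhs i).

Definition solver_guarantee (p : {poly {poly R}}) (A P : 'M[R]_n) (i : nat)
    : Prop :=
  representable fp (call_output i) /\
  lesssim p n (roundoff fp)
    (enorm (call_output i - invmx (normal_mx A P) *m call_rhs i))
    (cond A * roundoff fp * enorm (call_rhs i)).

End MetaSolver.

(* Main.v *)
Require Import Defs.
From mathcomp Require Import all_boot all_order all_algebra polyXY.
From mathcomp Require Import boolp classical_sets reals exp.
From mathcomp Require Import ring lra.
Import Order.TTheory GRing.Theory Num.Theory.
Local Open Scope ring_scope.

(** Write [a = ||A||], [a' = ||A^-1||], [W = A P^-1] and [eps = kappa u].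
    The preconditioned matrix [W] and its inverse have norm of order 1, so
    [P = W^-1 A] and [P^-1 = A^-1 W] have norm of order [a] and [a']. Every
    backward error in a product or solve is of relative size [u] with respect
    to [a], and it meets at most one factor [a'] on its way to the residual;
    since [a a' <= kappa], it costs a relative error of order [eps].

    One refinement step from an iterate with residual [r] thus works as
    follows. The computed residual is [s = r + O(a u ||x|| + eps ||r||)]
    ([computed_residual_err]): the rounding of [b] and [A xi], vectors as large
    as [a ||x||], brings in an error not proportional to [||r||], and so does
    the rounding of the new iterate, but nothing else does. The right-hand
    side is [c = W^T s] up to [O(eps ||s||)] ([computed_rhs_err]), and the
    exact solution of [W^T W y = W^T s] is [W^-1 s], so that the correction
    [e = P^-1 y] satisfies [A e = W W^-1 s = s] up to [O(eps ||s||)]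
    ([computed_correction_err]). It matters that the error of [e] is measured
    through [A e = W (P e)]: the solve with [P] has a small residual [P e - y],
    and [W] does not amplify it. Hence the residuals satisfy
    [||r+|| <= O(a u ||x||) + O(eps) ||r||] ([refinement_step]), a contraction
    whose solution is the asserted bound ([iterate_residual]).

    For the last claim, the number of steps is chosen so that
    [(c eps)^T <= u] ([iteration_count]); then the error of the iterate is at
    most [||x|| / 2], the iterate is at least half as large, and a small
    residual is a small rank-one backward error
    ([backward_error_of_residual]).

    The condition number is defined by singular values, while the analysis
    needs norms; the link is [specnorm_mul_inv_le_cond]. All polynomials of the
    hypotheses and all absolute constants are bounded by the single quantity
    [M], the value of a polynomial that dominates them ([dominatingP]), and the
    polynomials of the conclusion are powers of [M] times numbers. *)

(** * Euclidean inner product and norm *)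

Section EuclideanNorm.
Context {R : realType}.

Definition dot {n} (y z : 'cV[R]_n) : R := (y^T *m z) 0 0.

Lemma dotDl {n} (x y z : 'cV[R]_n) : dot (x + y) z = dot x z + dot y z.
Proof. by rewrite /dot linearD /= mulmxDl [LHS]mxE. Qed.

Lemma dotZl {n} k (x y : 'cV[R]_n) : dot (k *: x) y = k * dot x y.
Proof. by rewrite /dot linearZ /= -scalemxAl [LHS]mxE. Qed.

Lemma dotC {n} (x y : 'cV[R]_n) : dot x y = dot y x.
Proof. by rewrite /dot -[in RHS](trmxK x) -trmx_mul [RHS]mxE. Qed.

Lemma dotDr {n} (x y z : 'cV[R]_n) : dot x (y + z) = dot x y + dot x z.
Proof. by rewrite dotC dotDl !(dotC x). Qed.

Lemma dotZr {n} k (x y : 'cV[R]_n) : dot x (k *: y) = k * dot x y.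
Proof. by rewrite dotC dotZl dotC. Qed.

Lemma dot_mulmxr {n} (B : 'M[R]_n) (x y : 'cV_n) :
  dot x (B *m y) = dot (B^T *m x) y.
Proof. by rewrite /dot trmx_mul trmxK mulmxA. Qed.

Lemma dot_diag {n} (z : 'cV[R]_n) : dot z z = enorm z ^+ 2.
Proof.
rewrite /enorm sqr_sqrtr ?sumr_ge0// => [|i _]; last exact: sqr_ge0.
by rewrite /dot mxE; apply: eq_bigr => i _; rewrite mxE expr2.
Qed.

Lemma enorm_ge0 {n} (z : 'cV[R]_n) : 0 <= enorm z.
Proof. exact: sqrtr_ge0. Qed.

Lemma enorm_eq0 {n} (z : 'cV[R]_n) : (enorm z == 0) = (z == 0).
Proof.
apply/idP/eqP => [|->]; last first.
  by rewrite /enorm big1 ?sqrtr0// => i _; rewrite mxE expr0n.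
rewrite -sqrf_eq0 -dot_diag /dot mxE psumr_eq0 => [/allP h|i _]; last first.
  by rewrite mxE -expr2 sqr_ge0.
apply/matrixP => i j; rewrite ord1 mxE.
by have := h i (mem_index_enum i); rewrite mxE -expr2 sqrf_eq0 => /eqP.
Qed.

Lemma enorm0 {n} : enorm (0 : 'cV[R]_n) = 0.
Proof. by apply/eqP; rewrite enorm_eq0. Qed.

Lemma enormZ {n} k (z : 'cV[R]_n) : enorm (k *: z) = `|k| * enorm z.
Proof.
apply/eqP; rewrite -(@eqrXn2 _ 2) ?mulr_ge0 ?enorm_ge0 ?normr_ge0//.
by rewrite exprMn -!dot_diag dotZl dotZr real_normK ?num_real// expr2 mulrA.
Qed.

Lemma enormN {n} (z : 'cV[R]_n) : enorm (- z) = enorm z.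
Proof. by rewrite -scaleN1r enormZ normrN1 mul1r. Qed.

Lemma enormC {n} (y z : 'cV[R]_n) : enorm (y - z) = enorm (z - y).
Proof. by rewrite -enormN opprB. Qed.

(** When [c = 0] the affine function [a + 2 b t] is bounded below only if
    [b = 0]; otherwise the minimum is at [t = - b / c]. *)
Lemma discriminant_le0 (a b c : R) :
  0 <= c -> (forall t, 0 <= a + 2 * b * t + c * t ^+ 2) -> b ^+ 2 <= a * c.
Proof.
rewrite le_eqVlt => /orP[/eqP<-|c0] h.
  have [->|b0] := eqVneq b 0; first by rewrite mulr0 expr0n.
  have := h (- (a + 1) / (2 * b)).
  have -> : 2 * b * (- (a + 1) / (2 * b)) = - (a + 1) by field.
  by lra.
have := h (- b / c).
have -> : a + 2 * b * (- b / c) + c * (- b / c) ^+ 2 = (a * c - b ^+ 2) / c.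
  by field; rewrite gt_eqF.
by rewrite pmulr_lge0 ?invr_gt0// subr_ge0.
Qed.

(** The form is nonnegative on the line [x + t y]. *)
Lemma psd_cauchy_schwarz {n} (H : 'M[R]_n) :
  H^T = H -> (forall z : 'cV_n, 0 <= dot z (H *m z)) ->
  forall x y : 'cV_n, dot x (H *m y) ^+ 2 <= dot x (H *m x) * dot y (H *m y).
Proof.
move=> Hsym Hpos x y; apply: discriminant_le0 => // t.
have := Hpos (x + t *: y).
rewrite mulmxDr -scalemxAr !dotDl !dotDr !dotZl !dotZr.
have -> : dot y (H *m x) = dot x (H *m y) by rewrite dotC dot_mulmxr Hsym.
by congr (0 <= _); ring.
Qed.

Lemma cauchy_schwarz {n} (x y : 'cV[R]_n) : `|dot x y| <= enorm x * enorm y.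
Proof.
rewrite -(@ler_pXn2r _ 2) ?nnegrE ?mulr_ge0 ?enorm_ge0 ?normr_ge0//.
rewrite real_normK ?num_real// exprMn -!dot_diag.
have := @psd_cauchy_schwarz n 1%:M (trmx1 _ _) _ x y.
by rewrite !mul1mx; apply=> z; rewrite mul1mx dot_diag sqr_ge0.
Qed.

Lemma dot_le {n} (x y : 'cV[R]_n) : dot x y <= enorm x * enorm y.
Proof. exact: le_trans (ler_norm _) (cauchy_schwarz x y). Qed.

Lemma enormD {n} (y z : 'cV[R]_n) : enorm (y + z) <= enorm y + enorm z.
Proof.
rewrite -(@ler_pXn2r _ 2) ?nnegrE ?addr_ge0 ?enorm_ge0//.
rewrite -dot_diag !dotDl !dotDr !dot_diag (dotC z y) sqrrD.
by have := dot_le y z; lra.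
Qed.

Lemma enormB {n} (y z : 'cV[R]_n) : enorm (y - z) <= enorm y + enorm z.
Proof. by rewrite -(enormN z) enormD. Qed.

Lemma enorm_dist {n} (x y z : 'cV[R]_n) :
  enorm (x - z) <= enorm (x - y) + enorm (y - z).
Proof. by rewrite -[x - z](subrKA y) enormD. Qed.

Lemma enorm_le_dist {n} (y z : 'cV[R]_n) : enorm y <= enorm z + enorm (y - z).
Proof. by rewrite -{1}[y](subrK z) addrC enormD. Qed.

Lemma enorm_le_entries {n} (k : R) (y z : 'cV[R]_n) :
  0 <= k -> (forall i, `|y i 0| <= k * `|z i 0|) -> enorm y <= k * enorm z.
Proof.
move=> k0 h; rewrite -(ger0_norm k0) -enormZ /enorm ler_wsqrtr//.
apply: ler_sum => i _.
rewrite -[leLHS]real_normK ?num_real// -[leRHS]real_normK ?num_real//.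
rewrite ler_sqr ?nnegrE// mxE.
by rewrite normrM (ger0_norm k0) h.
Qed.

End EuclideanNorm.

(** * Spectral norm and condition number *)

Section SpectralNorm.
Context {R : realType} {n : nat}.
Implicit Types B D : 'M[R]_n.

(** The Frobenius norm is a bound. The supremum in [specnorm] is meaningful only
    because some bound exists. *)
Lemma mulmx_bounded B :
  exists2 k, 0 <= k & forall z : 'cV[R]_n, enorm (B *m z) <= k * enorm z.
Proof.
pose k2 := \sum_i enorm (row i B)^T ^+ 2.
have k2_ge0 : 0 <= k2 by apply: sumr_ge0 => i _; exact: sqr_ge0.
exists (Num.sqrt k2); first exact: sqrtr_ge0.
move=> z; rewrite -(@ler_pXn2r _ 2) ?nnegrE ?mulr_ge0 ?enorm_ge0 ?sqrtr_ge0//.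
rewrite exprMn (sqr_sqrtr k2_ge0) -[leLHS]dot_diag /dot mxE mulr_suml.
rewrite ler_sum// => i _.
rewrite mxE -expr2 -(real_normK (num_real _)) -exprMn.
have -> : (B *m z) i 0 = dot (row i B)^T z.
  by rewrite /dot trmxK -row_mul !mxE.
by rewrite ler_sqr ?nnegrE ?mulr_ge0 ?enorm_ge0// cauchy_schwarz.
Qed.

Lemma mulmx_specnorm B (z : 'cV[R]_n) :
  enorm (B *m z) <= specnorm B * enorm z.
Proof.
have [->|z0] := eqVneq z 0; first by rewrite mulmx0 !enorm0 mulr0.
have zgt0 : 0 < enorm z by rewrite lt_def enorm_eq0 z0 enorm_ge0.
rewrite -ler_pdivrMr// -[X in X <= _]ger0_norm ?divr_ge0 ?enorm_ge0//.
rewrite normrM (ger0_norm (enorm_ge0 _)) mulrC -enormZ scalemxAr.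
apply: ub_le_sup; last first.
  exists ((enorm z)^-1 *: z) => //=.
  by rewrite enormZ ger0_norm ?invr_ge0 ?enorm_ge0// mulVf ?gt_eqF.
have [k k0 h] := mulmx_bounded B.
exists k => _ [y /= y1 <-]; apply: le_trans (h y) _.
by rewrite -[leRHS]mulr1 ler_wpM2l.
Qed.

Lemma specnorm_le B k :
  0 <= k -> (forall z, enorm (B *m z) <= k * enorm z) -> specnorm B <= k.
Proof.
move=> k0 h; apply: ge_sup.
  by exists (enorm (B *m 0)), 0 => //=; rewrite enorm0.
move=> _ [y /= y1 <-]; apply: le_trans (h y) _.
by rewrite -[leRHS]mulr1 ler_wpM2l.
Qed.

Lemma specnorm_ge0 B : 0 <= specnorm B.
Proof.
have [k k0 h] := mulmx_bounded B.
apply: ub_le_sup; last by exists 0 => /=; rewrite ?mulmx0 enorm0.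
exists k => _ [y /= y1 <-]; apply: le_trans (h y) _.
by rewrite -[leRHS]mulr1 ler_wpM2l.
Qed.

Lemma specnormM B D : specnorm (B *m D) <= specnorm B * specnorm D.
Proof.
apply: specnorm_le => [|z]; first by rewrite mulr_ge0 ?specnorm_ge0.
rewrite -mulmxA -mulrA; apply: le_trans (mulmx_specnorm _ _) _.
by rewrite ler_wpM2l ?specnorm_ge0 ?mulmx_specnorm.
Qed.

Lemma specnorm_tr_le B : specnorm B^T <= specnorm B.
Proof.
apply: specnorm_le => [|z]; first exact: specnorm_ge0.
have [->|y0] := eqVneq (B^T *m z) 0.
  by rewrite enorm0 mulr_ge0 ?specnorm_ge0 ?enorm_ge0.
have y_gt0 : 0 < enorm (B^T *m z) by rewrite lt_def enorm_eq0 y0 enorm_ge0.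
rewrite -(ler_pM2r y_gt0) -expr2 -dot_diag -dot_mulmxr.
apply: le_trans (dot_le _ _) _.
by rewrite mulrC mulrAC ler_wpM2r ?enorm_ge0 ?mulmx_specnorm.
Qed.

Lemma specnorm_tr B : specnorm B^T = specnorm B.
Proof.
by apply/eqP; rewrite eq_le specnorm_tr_le -{1}[B]trmxK specnorm_tr_le.
Qed.

Hypothesis n_gt0 : (0 < n)%N.

Lemma exists_enorm_gt0 : exists z : 'cV[R]_n, 0 < enorm z.
Proof.
exists (\col_i 1); rewrite lt_def enorm_ge0 andbT enorm_eq0.
apply/eqP => /matrixP /(_ (Ordinal n_gt0) 0)/eqP.
by rewrite !mxE oner_eq0.
Qed.

Lemma specnorm1 : specnorm (1%:M : 'M[R]_n) = 1.
Proof.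
apply/eqP; rewrite eq_le specnorm_le//=; last first.
  by move=> z; rewrite mul1mx mul1r.
have [z z_gt0] := exists_enorm_gt0.
by have := mulmx_specnorm 1%:M z; rewrite mul1mx -{1}[enorm z]mul1r ler_pM2r.
Qed.

(** Cauchy-Schwarz for the form of [H], applied to [H z] and [z], gives
    [||H z||^2 <= ||H|| <z, H z>], and [||z|| <= ||H^-1|| ||H z||]. *)
Lemma psd_unit_coercive (H : 'M[R]_n) :
  H^T = H -> (forall z : 'cV_n, 0 <= dot z (H *m z)) -> H \in unitmx ->
  exists2 c, 0 < c & forall z : 'cV_n, c * enorm z ^+ 2 <= dot z (H *m z).
Proof.
move=> Hsym Hpos Hunit.
have HsqrH (z : 'cV_n) : enorm (H *m z) ^+ 2 <= specnorm H * dot z (H *m z).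
  have [->|y0] := eqVneq (H *m z) 0.
    by rewrite enorm0 expr0n mulr_ge0 ?specnorm_ge0// /dot mulmx0 mxE.
  have y_gt0 : 0 < enorm (H *m z) by rewrite lt_def enorm_eq0 y0 enorm_ge0.
  have := psd_cauchy_schwarz H Hsym Hpos (H *m z) z.
  rewrite dot_diag => cs.
  rewrite -(@ler_pM2r _ (enorm (H *m z) ^+ 2)) ?exprn_gt0// -expr2.
  apply: le_trans cs _; rewrite [leRHS]mulrAC ler_wpM2r//.
  apply: le_trans (dot_le _ _) _; rewrite expr2 mulrCA ler_wpM2l ?enorm_ge0//.
  exact: mulmx_specnorm.
pose k := specnorm (invmx H).
have k_lo (z : 'cV_n) : enorm z <= k * enorm (H *m z).
  by rewrite -{1}(mulKmx Hunit z) mulmx_specnorm.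
have kH : 1 <= k * specnorm H.
  by rewrite -specnorm1 -(mulVmx Hunit) specnormM.
have H_gt0 : 0 < specnorm H.
  rewrite lt_def specnorm_ge0 andbT; apply/negP => /eqP h.
  by move: kH; rewrite h mulr0 ler10.
have k_gt0 : 0 < k by rewrite -(pmulr_lgt0 _ H_gt0) (lt_le_trans ltr01).
pose c := (k ^+ 2 * specnorm H)^-1.
have c_gt0 : 0 < c by rewrite invr_gt0 mulr_gt0 ?exprn_gt0.
exists c => // z.
rewrite mulrC ler_pdivrMr ?mulr_gt0 ?exprn_gt0//.
apply: (@le_trans _ _ (k ^+ 2 * enorm (H *m z) ^+ 2)).
  by rewrite -exprMn ler_sqr ?nnegrE ?mulr_ge0 ?enorm_ge0// ltW.
by rewrite [leRHS]mulrCA ler_wpM2l ?sqr_ge0// [leRHS]mulrC.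
Qed.

(** Otherwise [H = mu^2 - B^T B], with [mu = ||B||], would be invertible. As it
    is also positive semidefinite, it would be bounded below by some [c > 0],
    and [B] would be bounded by [sqrt (mu^2 - c) < mu]. This yields an
    eigenvector without any compactness of the unit sphere. *)
Lemma specnorm_singular B : singular_values B (specnorm B).
Proof.
split; first exact: specnorm_ge0.
rewrite /eigenvalue /eigenspace kermx_eq0 row_free_unit.
set mu := specnorm B; apply/negP => Gunit.
pose H := mu ^+ 2 *: 1%:M - B^T *m B.
have Hunit : H \in unitmx.
  have -> : H = -1 *: (B^T *m B - (mu ^+ 2)%:M).
    by rewrite scaleN1r opprB /H scalemx1.
  by rewrite unitmxZ ?unitrN ?unitr1.
have Hsym : H^T = H.
  by rewrite /H linearB linearZ /= trmx1 trmx_mul trmxK.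
have HE (z : 'cV_n) :
    dot z (H *m z) = mu ^+ 2 * enorm z ^+ 2 - enorm (B *m z) ^+ 2.
  rewrite /H mulmxBl -scalemxAl mul1mx dotDr dotZr dot_diag -mulNmx.
  rewrite -scaleN1r -scalemxAl dotZr -mulmxA dot_mulmxr trmxK.
  by rewrite dot_diag mulN1r.
have Hpos (z : 'cV_n) : 0 <= dot z (H *m z).
  rewrite HE subr_ge0 -exprMn.
  rewrite ler_sqr ?nnegrE ?mulr_ge0 ?enorm_ge0 ?specnorm_ge0//.
  exact: mulmx_specnorm.
have [c c_gt0 c_lo] := psd_unit_coercive H Hsym Hpos Hunit.
have Bz (z : 'cV_n) : enorm (B *m z) ^+ 2 <= (mu ^+ 2 - c) * enorm z ^+ 2.
  by have := c_lo z; rewrite HE; lra.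
have m_ge0 : 0 <= mu ^+ 2 - c.
  have [z z_gt0] := exists_enorm_gt0.
  rewrite -(@pmulr_lge0 _ (enorm z ^+ 2)) ?exprn_gt0//.
  by apply: le_trans (Bz z); exact: sqr_ge0.
have : mu <= Num.sqrt (mu ^+ 2 - c).
  apply: specnorm_le => [|z]; first exact: sqrtr_ge0.
  rewrite -(@ler_pXn2r _ 2) ?nnegrE ?mulr_ge0 ?enorm_ge0 ?sqrtr_ge0//.
  by rewrite exprMn (sqr_sqrtr m_ge0).
rewrite -(@ler_pXn2r _ 2) ?nnegrE ?specnorm_ge0 ?sqrtr_ge0// (sqr_sqrtr m_ge0).
by rewrite lerBrDr gerDl leNgt c_gt0.
Qed.



Lemma singular_values_le B s : singular_values B s -> s <= specnorm B.
Proof.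
move=> [s_ge0 /eigenvalueP [v vB v0]].
have zE : B^T *m B *m v^T = s ^+ 2 *: v^T.
  by rewrite -linearZ /= -vB !trmx_mul trmxK.
have z_gt0 : 0 < enorm v^T.
  by rewrite lt_def enorm_ge0 andbT enorm_eq0 trmx_eq0.
rewrite -(ler_pM2r z_gt0).
rewrite -(@ler_pXn2r _ 2) ?nnegrE ?mulr_ge0 ?enorm_ge0 ?specnorm_ge0//.
rewrite exprMn -dot_diag -dotZr -zE -mulmxA dot_mulmxr trmxK dot_diag.
by rewrite ler_sqr ?nnegrE ?mulr_ge0 ?enorm_ge0 ?specnorm_ge0 ?mulmx_specnorm.
Qed.

Lemma specnorm_le_sigma_max B : specnorm B <= sigma_max B.
Proof.
apply: ub_le_sup; last exact: specnorm_singular.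
by exists (specnorm B) => s; exact: singular_values_le.
Qed.

(** The largest singular value of [B^-T] is the inverse of one of [B], because
    [B^-1 B^-T] is the inverse of [B^T B]. *)
Lemma specnorm_invmx_singular B :
  B \in unitmx -> singular_values B (specnorm (invmx B))^-1.
Proof.
move=> Bunit; split; first by rewrite invr_ge0 specnorm_ge0.
have [_] := specnorm_singular (invmx B)^T.
rewrite specnorm_tr trmxK; set s := specnorm _.
move=> /eigenvalueP [v vB v0]; apply/eigenvalueP.
have s_neq0 : s != 0.
  apply/eqP => s0; have := @specnormM B (invmx B).
  by rewrite mulmxV// specnorm1 -/s s0 mulr0 ler10.
exists v => //.
have BTB : invmx B *m (invmx B)^T *m (B^T *m B) = 1%:M.
  by rewrite mulmxA -(mulmxA (invmx B)) -trmx_mul mulmxV// trmx1 mulmx1 mulVmx.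
have : v *m (invmx B *m (invmx B)^T) *m (B^T *m B) = v.
  by rewrite -mulmxA BTB mulmx1.
rewrite vB -scalemxAl => h.
by rewrite -{2}h scalerA -exprMn mulVf// expr1n scale1r.
Qed.

Lemma specnormV_gt0 B : B \in unitmx -> 0 < specnorm (invmx B).
Proof.
move=> Bunit; rewrite lt_def specnorm_ge0 andbT; apply/eqP => h.
have := @specnormM B (invmx B).
by rewrite mulmxV// specnorm1 h mulr0 ler10.
Qed.

(** [||B||] is a singular value of [B], and [||B^-1||^-1] is the least one;
    being positive, the latter makes the division in [cond] a genuine one. *)
Lemma specnorm_mul_inv_le_cond B :
  B \in unitmx -> specnorm B * specnorm (invmx B) <= cond B.
Proof.
move=> Bunit; have s_gt0 := specnormV_gt0 _ Bunit.
have smin_le : sigma_min B <= (specnorm (invmx B))^-1.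
  apply: ge_inf; last exact: specnorm_invmx_singular.
  by exists 0 => s [].
have smin_ge : (specnorm (invmx B))^-1 <= sigma_min B.
  apply: lb_le_inf.
    by exists (specnorm (invmx B))^-1; exact: specnorm_invmx_singular.
  move=> s [s_ge0 /eigenvalueP [v vB v0]].
  have z_gt0 : 0 < enorm v^T.
    by rewrite lt_def enorm_ge0 andbT enorm_eq0 trmx_eq0.
  have zE : enorm (B *m v^T) = s * enorm v^T.
    apply/eqP; rewrite -(@eqrXn2 _ 2) ?mulr_ge0 ?enorm_ge0//.
    rewrite exprMn -!dot_diag -dotZl dot_mulmxr mulmxA.
    by rewrite -linearZ /= -vB !trmx_mul trmxK.
  rewrite -(ler_pM2r z_gt0) -zE mulrC ler_pdivrMr// mulrC.
  by rewrite -{1}(mulKmx Bunit v^T) mulmx_specnorm.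
have -> : specnorm (invmx B) = (sigma_min B)^-1.
  by apply: invr_inj; apply/eqP; rewrite invrK eq_le smin_ge smin_le.
rewrite /cond ler_wpM2r ?specnorm_le_sigma_max// invr_ge0.
by apply: le_trans smin_ge; rewrite invr_ge0 specnorm_ge0.
Qed.

End SpectralNorm.

(** * Rounding errors of vectors *)

Section RoundedVectors.
Context {R : realType} {fp : fp_arith R} {n : nat}.
Local Notation u := (roundoff fp).
Implicit Types y z : 'cV[R]_n.

Lemma representable_entry y i : representable fp y -> fl fp (y i 0) = y i 0.
Proof. by move=> /matrixP/(_ i 0); rewrite mxE. Qed.

Lemma representable0 : representable fp (0 : 'cV[R]_n).
Proof.
apply/matrixP => i j; rewrite !mxE; apply/eqP; rewrite -normr_le0.
by have := fl_err fp 0; rewrite subr0 normr0 mulr0.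
Qed.

Lemma representable_fl_vec z : representable fp (fl_vec fp z).
Proof. by apply/matrixP => i j; rewrite !mxE fl_idem. Qed.

Lemma fl_vec_err z : enorm (fl_vec fp z - z) <= u * enorm z.
Proof.
apply: enorm_le_entries => [|i]; first exact: ltW (roundoff_gt0 fp).
by rewrite !mxE fl_err.
Qed.

Lemma fl_vadd_err y z : representable fp y -> representable fp z ->
  representable fp (fl_vadd fp y z) /\
  enorm (fl_vadd fp y z - (y + z)) <= u * enorm (y + z).
Proof.
move=> yr zr.
have addP i :=
  fl_addP (representable_entry y i yr) (representable_entry z i zr).
split; first by apply/matrixP => i j; rewrite ord1 !mxE; have [] := addP i.
apply: enorm_le_entries => [|i]; first exact: ltW (roundoff_gt0 fp).
by rewrite !mxE; have [] := addP i.
Qed.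

Lemma fl_vsub_err y z : representable fp y -> representable fp z ->
  representable fp (fl_vsub fp y z) /\
  enorm (fl_vsub fp y z - (y - z)) <= u * enorm (y - z).
Proof.
move=> yr zr.
have subP i :=
  fl_subP (representable_entry y i yr) (representable_entry z i zr).
split; first by apply/matrixP => i j; rewrite ord1 !mxE; have [] := subP i.
apply: enorm_le_entries => [|i]; first exact: ltW (roundoff_gt0 fp).
by rewrite !mxE; have [] := subP i.
Qed.

End RoundedVectors.

Lemma lesssim_le {R : realType} (p : {poly {poly R}}) n (u M a b : R) :
  prefactor p n u <= M -> 0 <= b -> lesssim p n u a b -> a <= M * b.
Proof. by move=> pM b0 /le_trans; apply; rewrite ler_wpM2r. Qed.

(** * One step of iterative refinement *)

Section RefinementStep.
Context {R : realType} {fp : fp_arith R} {n : nat} {A P : 'M[R]_n}.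
Context {ops : fl_operators R n} {b : 'cV[R]_n}.
Context {pA pAT pP pPT : {poly {poly R}}} {M : R}.
Local Notation u := (roundoff fp).
Local Notation W := (A *m invmx P).
Local Notation x := (invmx A *m b).
Local Notation eps := (cond A * u).
Local Notation a := (specnorm A).
Local Notation a' := (specnorm (invmx A)).

Hypothesis n_gt0 : (0 < n)%N.
Hypothesis Aunit : A \in unitmx.
Hypothesis Punit : P \in unitmx.
Hypothesis stable : backward_stable_operators fp pA pAT pP pPT A P ops.
Hypothesis M_ge1 : 1 <= M.
Hypothesis pA_le : prefactor pA n u <= M.
Hypothesis pAT_le : prefactor pAT n u <= M.
Hypothesis pP_le : prefactor pP n u <= M.
Hypothesis pPT_le : prefactor pPT n u <= M.
Hypothesis W_le : specnorm W <= M.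
Hypothesis WV_le : specnorm (invmx W) <= M.
Hypothesis eps_small : 22 * M ^+ 7 * eps <= 1.

Let M_ge0 : 0 <= M. Proof. exact: le_trans ler01 M_ge1. Qed.
Let u_ge0 : 0 <= u. Proof. exact: ltW (roundoff_gt0 fp). Qed.
Let u_le1 : u <= 1. Proof. exact: ltW (roundoff_lt1 fp). Qed.
Let a_ge0 : 0 <= a. Proof. exact: specnorm_ge0. Qed.
Let a'_ge0 : 0 <= a'. Proof. exact: specnorm_ge0. Qed.
Let aa'_le : a * a' <= cond A.
Proof. exact: specnorm_mul_inv_le_cond. Qed.
Let aa'_ge1 : 1 <= a * a'.
Proof. by rewrite -(specnorm1 n_gt0) -(mulmxV Aunit) specnormM. Qed.

(** The condition number is at least 1; errors of relative size [u] may
    therefore be counted among those of relative size [eps]. *)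
Lemma roundoff_le_eps : u <= eps.
Proof. by rewrite -[leLHS]mul1r ler_wpM2r// (le_trans aa'_ge1). Qed.

Let eps_ge0 : 0 <= eps. Proof. exact: le_trans roundoff_le_eps. Qed.

Let mul_aa'u k : 0 <= k -> k * (a * a' * u) <= k * eps.
Proof. by move=> k0; rewrite ler_wpM2l// ler_wpM2r. Qed.

Let pow_eps j k : (j <= k)%N -> M ^+ j * eps <= M ^+ k * eps.
Proof. by move=> jk; rewrite ler_wpM2r// ler_weXn2l. Qed.

Let pow_eps_mul j k v : 0 <= v -> (j <= k)%N ->
  M ^+ j * eps * v <= M ^+ k * eps * v.
Proof. by move=> v0 jk; rewrite ler_wpM2r// pow_eps. Qed.

Let Wunit : W \in unitmx. Proof. by rewrite unitmx_mul Aunit unitmx_inv. Qed.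

Let mulWP : W *m P = A. Proof. by rewrite mulmxKV. Qed.

Let invP : invmx P = invmx A *m W. Proof. by rewrite mulKmx. Qed.

Let P_le : specnorm P <= M * a.
Proof.
have -> : P = invmx W *m A by rewrite -{2}mulWP mulKmx.
by apply: le_trans (specnormM _ _) _; rewrite ler_wpM2r.
Qed.

Let PV_le : specnorm (invmx P) <= M * a'.
Proof.
rewrite invP mulrC; apply: le_trans (specnormM _ _) _.
by rewrite ler_wpM2l.
Qed.

Let mulmx_le B k v w : specnorm B <= k -> 0 <= k -> enorm v <= w ->
  enorm (B *m v : 'cV[R]_n) <= k * w.
Proof.
move=> Bk k0 vw; apply: le_trans (mulmx_specnorm _ _) _.
by rewrite ler_pM ?specnorm_ge0 ?enorm_ge0.
Qed.

(** The backward error [dB] of the solve turns into a residual [- dB (f z)].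
    It is proportional to the computed solution, not to [z], so each use has to
    bound that solution as well; [B] stands for [P] or [P^T]. *)
Lemma stable_solve_residual (p : {poly {poly R}}) (B : 'M[R]_n) f z :
  prefactor p n u <= M -> specnorm B <= M * a -> stable_solve fp p B f ->
  representable fp z ->
  representable fp (f z) /\
  exists2 e, B *m f z = z + e & enorm e <= M ^+ 2 * a * u * enorm (f z).
Proof.
move=> pM BM /(_ z) st zr; have [fzr [dB [dBz dB_le]]] := st zr.
split=> //; exists (- (dB *m f z)).
  by rewrite -{2}dBz mulmxDl addrK.
rewrite enormN; apply: mulmx_le => //; last by rewrite !mulr_ge0 ?exprn_ge0.
apply: le_trans (lesssim_le _ _ _ _ _ _ pM _ dB_le) _.
  by rewrite mulr_ge0 ?specnorm_ge0.
rewrite expr2 -!mulrA ler_wpM2l// [leRHS]mulrA ler_wpM2r//.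
Qed.

(** The rounding errors of [b] and of [A xi] are relative to [a ||x||] and
    [a ||xi||], and [||xi||] exceeds [||x||] by at most [a' ||r||]: this splits
    the error into a part of order [a u ||x||], where the residual stagnates,
    and a part of order [eps ||r||], which shrinks with the residual. *)
Lemma computed_residual_err (xi : 'cV[R]_n) :
  representable fp xi ->
  let s := fl_vsub fp (fl_vec fp b) (flA ops xi) in
  let r := b - A *m xi in
  representable fp s /\
  enorm (s - r) <= 4 * M * (a * u * enorm x) + 3 * M * eps * enorm r.
Proof.
move=> xir s r.
have [gr g_err] := stable_A stable xir.
have b_err := @fl_vec_err R fp n b.
have [sr s_err] := fl_vsub_err _ _ (representable_fl_vec b) gr.
split=> //.
set g := flA ops xi in gr g_err s_err s *.
set bf := fl_vec fp b in b_err s_err s *.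
have {g_err} g_err : enorm (g - A *m xi) <= M * (a * enorm xi * u).
  by apply: lesssim_le g_err => //; rewrite !mulr_ge0 ?enorm_ge0.
have bE : b = A *m x by rewrite mulKVmx.
have b_le : enorm b <= a * enorm x by rewrite {1}bE mulmx_specnorm.
have xi_le : enorm xi <= enorm x + a' * enorm r.
  apply: le_trans (enorm_le_dist xi x) _; rewrite lerD2l enormC.
  by rewrite -{1}(mulKmx Aunit xi) -mulmxBr mulmx_specnorm.
have t_le : enorm (bf - g - r) <= enorm (bf - b) + enorm (g - A *m xi).
  have -> : bf - g - r = (bf - b) - (g - A *m xi).
    by apply/matrixP => i j; rewrite /r !mxE; ring.
  exact: enormB.
have s_le : enorm (s - r) <= enorm (s - (bf - g)) + enorm (bf - g - r).
  exact: enorm_dist.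
have bfg_le : enorm (bf - g) <= enorm r + enorm (bf - g - r).
  exact: enorm_le_dist.
have {}s_err : enorm (s - (bf - g)) <= u * enorm r + enorm (bf - g - r).
  apply: le_trans s_err _; apply: le_trans (ler_wpM2l u_ge0 bfg_le) _.
  by rewrite mulrDr lerD2l -[leRHS]mul1r ler_wpM2r ?enorm_ge0.
have {}b_err : enorm (bf - b) <= a * u * enorm x.
  by apply: le_trans b_err _; rewrite mulrAC [leRHS]mulrC ler_wpM2l.
have {}g_err : enorm (g - A *m xi) <=
    M * (a * u * enorm x) + M * eps * enorm r.
  apply: le_trans g_err _.
  have := ler_wpM2l (mulr_ge0 (mulr_ge0 M_ge0 a_ge0) u_ge0) xi_le.
  have := mul_aa'u (M * enorm r) (mulr_ge0 M_ge0 (enorm_ge0 _)).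
  by lra.
have y_le : a * u * enorm x <= M * (a * u * enorm x).
  by rewrite -[leLHS]mul1r ler_wpM2r ?mulr_ge0 ?enorm_ge0.
have u_r : u * enorm r <= eps * enorm r.
  by rewrite ler_wpM2r ?enorm_ge0 ?roundoff_le_eps.
have eps_r : eps * enorm r <= M * eps * enorm r.
  by rewrite ler_wpM2r ?enorm_ge0 // -[leLHS]mul1r ler_wpM2r.
by lra.
Qed.

(** Both the error of the product with [A^T] and the residual of the solve with
    [P^T] are multiplied by [P^-T], of norm at most [M a']. The second is
    proportional to [||c||] itself and is absorbed because [eps] is small. *)
Lemma computed_rhs_err (s : 'cV[R]_n) :
  representable fp s ->
  let c := flPinvT ops (flAT ops s) in
  [/\ representable fp c, enorm c <= 3 * M * enorm s &
      enorm (c - W^T *m s) <= 4 * M ^+ 4 * eps * enorm s].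
Proof.
move=> sr c.
have [hr h_err] := stable_AT stable sr.
have PT_le : specnorm P^T <= M * a by rewrite specnorm_tr.
have [cr [e cE e_le]] :=
  stable_solve_residual _ _ _ _ pPT_le PT_le (stable_PinvT stable) hr.
rewrite -/c in cr cE e_le.
have {}h_err : enorm (flAT ops s - A^T *m s) <= M * (a * enorm s * u).
  by apply: lesssim_le h_err => //; rewrite !mulr_ge0 ?enorm_ge0.
have cW : c - W^T *m s = (invmx P)^T *m (flAT ops s - A^T *m s + e).
  have -> : c = (invmx P)^T *m (P^T *m c).
    by rewrite mulmxA -trmx_mul mulmxV// trmx1 mul1mx.
  by rewrite cE trmx_mul -mulmxA -mulmxBr addrAC.
have PVT_le : specnorm (invmx P)^T <= M * a' by rewrite specnorm_tr.
have Ws_le : enorm (W^T *m s) <= M * enorm s.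
  by apply: mulmx_le => //; rewrite specnorm_tr.
have c_le : enorm (c - W^T *m s) <=
    M ^+ 2 * eps * enorm s + M ^+ 3 * eps * enorm c.
  have := mulmx_le _ _ _ _ PVT_le (mulr_ge0 M_ge0 a'_ge0)
    (le_trans (enormD _ _) (lerD h_err e_le)).
  rewrite -cW.
  have := mul_aa'u (M ^+ 2 * enorm s)
    (mulr_ge0 (exprn_ge0 _ M_ge0) (enorm_ge0 _)).
  have := mul_aa'u (M ^+ 3 * enorm c)
    (mulr_ge0 (exprn_ge0 _ M_ge0) (enorm_ge0 _)).
  by lra.
have nc_le : enorm c <= 3 * M * enorm s.
  have := enorm_le_dist c (W^T *m s).
  have := pow_eps_mul 2 7 _ (enorm_ge0 s) isT.
  have := pow_eps_mul 3 7 _ (enorm_ge0 c) isT.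
  have := ler_wpM2r (enorm_ge0 s) eps_small.
  have := ler_wpM2r (enorm_ge0 c) eps_small.
  have := ler_wpM2r (enorm_ge0 s) M_ge1.
  have := enorm_ge0 s.
  by lra.
split=> //; apply: le_trans c_le _.
have := pow_eps_mul 2 4 _ (enorm_ge0 s) isT.
have := ler_wpM2l (mulr_ge0 (exprn_ge0 3 M_ge0) eps_ge0) nc_le.
by lra.
Qed.

(** The normal matrix is [W^T W], so the exact solution for [c = W^T s] is
    [W^-1 s]. With [P e = d + f], the error of [A e = W (d + f)] contains the
    residual [f] of the solve multiplied by [W] only; [f] has size
    [a u ||e||], and [||e||] contributes the factor [a']. *)
Lemma computed_correction_err (s d : 'cV[R]_n) :
  representable fp s -> representable fp d ->
  let c := flPinvT ops (flAT ops s) in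
  enorm (d - invmx (normal_mx A P) *m c) <= M * (eps * enorm c) ->
  let e := flPinv ops d in
  representable fp e /\
  enorm (A *m e - s) <= 11 * M ^+ 7 * eps * enorm s.
Proof.
move=> sr dr c d_err e.
have [cr c_le c_err] := computed_rhs_err s sr.
rewrite -/c in cr c_le c_err.
have [er [f eE f_le]] :=
  stable_solve_residual _ _ _ _ pP_le P_le (stable_Pinv stable) dr.
rewrite -/e in er eE f_le.
split=> //.
have WVT_le : specnorm (invmx W)^T <= M by rewrite specnorm_tr.
have normalV v : invmx (normal_mx A P) *m v =
    invmx W *m ((invmx W)^T *m v) :> 'cV[R]_n.
  have NE : normal_mx A P = W^T *m W.
    by rewrite /normal_mx trmx_mul !mulmxA.
  have Nunit : W^T *m W \in unitmx by rewrite unitmx_mul unitmx_tr Wunit.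
  rewrite NE; apply: (can_inj (mulKmx Nunit)); rewrite mulKVmx//.
  by rewrite -mulmxA mulKVmx// mulmxA -trmx_mul mulVmx// trmx1 mul1mx.
have dW_le : enorm (d - invmx W *m s) <= 7 * M ^+ 6 * eps * enorm s.
  have dE : d - invmx W *m s = (d - invmx (normal_mx A P) *m c)
      + invmx W *m ((invmx W)^T *m (c - W^T *m s)).
    rewrite mulmxBr (mulmxA _ W^T) -trmx_mul mulmxV// trmx1 mul1mx mulmxBr.
    by rewrite normalV addrA subrK.
  have := mulmx_le _ _ _ _ WV_le M_ge0 (mulmx_le _ _ _ _ WVT_le M_ge0 c_err).
  have := enormD (d - invmx (normal_mx A P) *m c)
      (invmx W *m ((invmx W)^T *m (c - W^T *m s))).
  rewrite -dE.
  have := ler_wpM2l (mulr_ge0 M_ge0 eps_ge0) c_le.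
  have := pow_eps_mul 2 6 _ (enorm_ge0 s) isT.
  by lra.
have d_le : enorm d <= 2 * M * enorm s.
  have := enorm_le_dist d (invmx W *m s).
  have := mulmx_le _ _ _ _ WV_le M_ge0 (lexx (enorm s)).
  have := pow_eps_mul 6 7 _ (enorm_ge0 s) isT.
  have := ler_wpM2r (enorm_ge0 s) eps_small.
  have := ler_wpM2r (enorm_ge0 s) M_ge1.
  have := enorm_ge0 s.
  by lra.
have e_le : enorm e <= 4 * M ^+ 2 * a' * enorm s.
  have eP : e = invmx P *m (d + f) by rewrite -eE mulKmx.
  have := mulmx_le _ _ _ _ PV_le (mulr_ge0 M_ge0 a'_ge0)
    (le_trans (enormD _ _) (lerD d_le f_le)).
  rewrite -eP.
  have := mul_aa'u (M ^+ 3 * enorm e)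
    (mulr_ge0 (exprn_ge0 _ M_ge0) (enorm_ge0 _)).
  have := pow_eps_mul 3 7 _ (enorm_ge0 e) isT.
  have := ler_wpM2r (enorm_ge0 e) eps_small.
  have := enorm_ge0 e.
  by lra.
have AeE : A *m e - s = W *m (d - invmx W *m s) + W *m f.
  rewrite -{1}mulWP -mulmxA eE mulmxDr mulmxBr mulKVmx//.
  by rewrite addrAC.
have := enormD (W *m (d - invmx W *m s)) (W *m f).
rewrite -AeE.
have := mulmx_le _ _ _ _ W_le M_ge0 dW_le.
have := mulmx_le _ _ _ _ W_le M_ge0 f_le.
have M2au : 0 <= M ^+ 3 * a * u by rewrite !mulr_ge0 ?exprn_ge0.
have := ler_wpM2l M2au e_le.
have := mul_aa'u (4 * M ^+ 5 * enorm s)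
  (mulr_ge0 (mulr_ge0 (ler0n _ 4) (exprn_ge0 _ M_ge0)) (enorm_ge0 _)).
have := pow_eps_mul 5 7 _ (enorm_ge0 s) isT.
by lra.
Qed.

(** The rounding of the update is relative to [||xi + e||], which is [||x||] up
    to [a' ||r - A e||]; multiplied by [A] it adds [a u ||x||] and
    [eps ||r - A e||]. *)
Lemma refinement_step (xi d : 'cV[R]_n) :
  representable fp xi -> representable fp d ->
  let c := fl_rhs fp ops b xi in
  enorm (d - invmx (normal_mx A P) *m c) <= M * (eps * enorm c) ->
  let xi' := fl_vadd fp xi (flPinv ops d) in
  representable fp xi' /\
  enorm (b - A *m xi') <=
    13 * M * (a * u * enorm x) + 31 * M ^+ 7 * eps * enorm (b - A *m xi).
Proof.
move=> xir dr c d_err xi'.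
have [sr s_err] := computed_residual_err xi xir.
set s := fl_vsub _ _ _ in sr s_err.
have [er e_err] := computed_correction_err s d sr dr d_err.
set e := flPinv ops d in er e_err.
have [xir' x_err] := fl_vadd_err _ _ xir er.
rewrite -/e -/xi' in xir' x_err.
split=> //; set r := b - A *m xi in s_err *.
have rAe_le : enorm (r - A *m e) <= enorm (s - r) + enorm (A *m e - s).
  by rewrite (enormC s r) (enormC (A *m e)) enorm_dist.
have s_le : enorm s <= enorm r + enorm (s - r) by exact: enorm_le_dist.
have xie_le : enorm (xi + e) <= enorm x + a' * enorm (r - A *m e).
  apply: le_trans (enorm_le_dist (xi + e) x) _; rewrite lerD2l enormC.
  have -> : x - (xi + e) = invmx A *m (r - A *m e).
    by rewrite /r !mulmxBr !mulKmx// opprD addrA.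
  exact: mulmx_specnorm.
have r'E : b - A *m xi' = (r - A *m e) - A *m (xi' - (xi + e)).
  rewrite mulmxBr mulmxDr /r; apply/matrixP => i j; rewrite !mxE; ring.
have := enormB (r - A *m e) (A *m (xi' - (xi + e))).
rewrite -r'E.
have := mulmx_le _ _ _ _ (lexx a) a_ge0 x_err.
have := ler_wpM2l (mulr_ge0 a_ge0 u_ge0) xie_le.
have := mul_aa'u _ (enorm_ge0 (r - A *m e)).
have eps_le1 : eps <= 1.
  have := pow_eps 0 7 isT; rewrite expr0 mul1r.
  by have := eps_ge0; have := eps_small; lra.
have := ler_wpM2r (enorm_ge0 (r - A *m e)) eps_le1.
have M7_ge0 : 0 <= M ^+ 7 * eps by rewrite mulr_ge0 ?exprn_ge0.
have := ler_wpM2l M7_ge0 s_le.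
have := ler_wpM2r (enorm_ge0 (s - r)) eps_small.
have := pow_eps_mul 1 7 _ (enorm_ge0 r) isT; rewrite expr1.
have y_ge0 : 0 <= a * u * enorm x by rewrite !mulr_ge0 ?enorm_ge0.
have := ler_wpM2r y_ge0 M_ge1.
by lra.
Qed.

End RefinementStep.

(** * The iteration *)

Section Iteration.
Context {R : realType} {fp : fp_arith R} {n : nat} {A P : 'M[R]_n}.
Context {ops : fl_operators R n} {solver : subroutine R n} {b : 'cV[R]_n}.
Context {pA pAT pP pPT pS : {poly {poly R}}} {M : R}.
Local Notation u := (roundoff fp).
Local Notation W := (A *m invmx P).
Local Notation x := (invmx A *m b).
Local Notation eps := (cond A * u).
Local Notation xhat := (iterate fp ops solver b).
Local Notation scale := (specnorm A * enorm x).

Hypothesis n_gt0 : (0 < n)%N.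
Hypothesis Aunit : A \in unitmx.
Hypothesis Punit : P \in unitmx.
Hypothesis stable : backward_stable_operators fp pA pAT pP pPT A P ops.
Hypothesis M_ge1 : 1 <= M.
Hypothesis pA_le : prefactor pA n u <= M.
Hypothesis pAT_le : prefactor pAT n u <= M.
Hypothesis pP_le : prefactor pP n u <= M.
Hypothesis pPT_le : prefactor pPT n u <= M.
Hypothesis pS_le : prefactor pS n u <= M.
Hypothesis W_le : specnorm W <= M.
Hypothesis WV_le : specnorm (invmx W) <= M.
Hypothesis rate_le : 2 * (31 * M ^+ 7 * eps) <= 1.

(** With [y = a u ||x||] and [q = 31 M^7 eps <= 1/2], the recurrence
    [r+ <= 13 M y + q r] preserves [r_i <= 26 M y + q^i a ||x||], because
    [26 q <= 13]; and [r_0 = ||b|| <= a ||x||]. *)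
Lemma iterate_residual t :
  (forall i, (i < t)%N -> solver_guarantee fp ops solver b pS A P i) ->
  forall i, (i <= t)%N ->
  representable fp (xhat i) /\
  enorm (b - A *m xhat i) <=
    26 * M * u * scale + (31 * M ^+ 7 * eps) ^+ i * scale.
Proof.
move=> guar.
have M_ge0 : 0 <= M by apply: le_trans M_ge1.
have eps_ge0 : 0 <= eps.
  by rewrite (le_trans _ (roundoff_le_eps n_gt0 Aunit)) ?ltW ?roundoff_gt0.
have c_ge0 : 0 <= 31 * M ^+ 7 * eps.
  by rewrite mulr_ge0// mulr_ge0 ?exprn_ge0.
have scale_ge0 : 0 <= scale by rewrite mulr_ge0 ?specnorm_ge0 ?enorm_ge0.
have y_ge0 : 0 <= M * u * scale.
  by rewrite mulr_ge0// mulr_ge0// ltW ?roundoff_gt0.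
elim=> [_|i IH lt_it].
  split; first exact: representable0.
  rewrite mulmx0 subr0 expr0 mul1r.
  have : enorm b <= scale by rewrite -{1}(mulKVmx Aunit b) mulmx_specnorm.
  by move: y_ge0; lra.
have [xr r_le] := IH (ltnW lt_it).
have [dr d_err] := guar i lt_it.
have {}d_err := lesssim_le _ _ _ _ _ _ pS_le
  (mulr_ge0 eps_ge0 (enorm_ge0 _)) d_err.
have eps_small : 22 * M ^+ 7 * eps <= 1 by move: rate_le c_ge0; lra.
have [x'r r'_le] := refinement_step n_gt0 Aunit Punit stable M_ge1 pA_le pAT_le
  pP_le pPT_le W_le WV_le eps_small _ _ xr dr d_err.
split=> //; apply: le_trans r'_le _; rewrite (exprS _ i).
have := ler_wpM2l c_ge0 r_le.
have := ler_wpM2r y_ge0 rate_le.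
(* The power has to be opaque: the exponent [i] is symbolic. *)
move: (_ ^+ i) => rate_i.
by lra.
Qed.

End Iteration.

(** The perturbation is the rank-one matrix [r z^T / ||z||^2], of norm
    [||r|| / ||z||]. The residual is given relative to the norm of the exact
    solution, and [2 delta kappa <= 1] ensures that [z] has at least half of
    that norm. *)
Lemma backward_error_of_residual {R : realType} {n} (A : 'M[R]_n)
    (b z : 'cV[R]_n) (delta : R) :
  (0 < n)%N -> A \in unitmx -> 0 <= delta -> 2 * (delta * cond A) <= 1 ->
  enorm (b - A *m z) <= delta * (specnorm A * enorm (invmx A *m b)) ->
  exists dA : 'M[R]_n, (A + dA) *m z = b /\
    specnorm dA <= 2 * delta * specnorm A.
Proof.
move=> n_gt0 Aunit delta_ge0 delta_small; set x := invmx A *m b; set r := b - _.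
move=> r_le.
have x_le : enorm x <= 2 * enorm z.
  have := enorm_le_dist x z.
  have -> : x - z = invmx A *m r by rewrite mulmxBr mulKmx.
  have := mulmx_specnorm (invmx A) r.
  have := ler_wpM2l (specnorm_ge0 (invmx A)) r_le.
  have := ler_wpM2r (mulr_ge0 delta_ge0 (enorm_ge0 x))
    (specnorm_mul_inv_le_cond n_gt0 _ Aunit).
  have := ler_wpM2r (enorm_ge0 x) delta_small.
  by lra.
have {}r_le : enorm r <= 2 * delta * specnorm A * enorm z.
  have := ler_wpM2l (mulr_ge0 delta_ge0 (specnorm_ge0 A)) x_le.
  by lra.
have k_ge0 : 0 <= 2 * delta * specnorm A by rewrite !mulr_ge0 ?specnorm_ge0.
have [z0|z_neq0] := eqVneq z 0.
  have r0 : r = 0.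
    apply/eqP; rewrite -enorm_eq0 eq_le enorm_ge0 andbT (le_trans r_le)//.
    by rewrite z0 enorm0 mulr0.
  exists 0; split.
    by rewrite addr0; apply/eqP; rewrite eq_sym -subr_eq0 -/r r0.
  by apply: specnorm_le => // y; rewrite mul0mx enorm0 mulr_ge0 ?enorm_ge0.
have z_gt0 : 0 < enorm z by rewrite lt_def enorm_eq0 z_neq0 enorm_ge0.
have dAE (y : 'cV_n) :
    (enorm z ^- 2 *: (r *m z^T)) *m y = (enorm z ^- 2 * dot z y) *: r.
  rewrite -scalemxAl -mulmxA -scalerA; congr (_ *: _).
  by rewrite [z^T *m y]mx11_scalar -/(dot z y) mul_mx_scalar.
exists (enorm z ^- 2 *: (r *m z^T)); split.
  rewrite mulmxDl dAE dot_diag mulVf ?expf_neq0 ?gt_eqF// scale1r.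
  by rewrite addrC subrK.
apply: specnorm_le => // y; rewrite dAE enormZ normrM.
rewrite (ger0_norm (_ : 0 <= enorm z ^- 2)) ?invr_ge0 ?exprn_ge0 ?enorm_ge0//.
apply: (@le_trans _ _ (enorm z ^- 2 * (enorm z * enorm y) *
                       (2 * delta * specnorm A * enorm z))).
  rewrite ler_pM ?enorm_ge0 ?mulr_ge0 ?invr_ge0 ?exprn_ge0 ?enorm_ge0//.
  by rewrite ler_wpM2l ?invr_ge0 ?exprn_ge0 ?enorm_ge0// cauchy_schwarz.
rewrite le_eqVlt; apply/orP; left; apply/eqP; field.
by rewrite gt_eqF.
Qed.

(** * Number of iterations and polynomial prefactors *)

Section IterationCount.
Context {R : realType} (u eps c : R).
Hypothesis u_gt0 : 0 < u.
Hypothesis u_le_eps : u <= eps.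
Hypothesis eps_lt1 : eps < 1.
Hypothesis c_ge1 : 1 <= c.
Hypothesis c2eps_le1 : c ^+ 2 * eps <= 1.

(** If [c^2 eps <= 1] then [c eps <= sqrt eps], so the factor [c] at most
    doubles the number [ln (1/u) / ln (1/eps)] of steps that [eps^t <= u] would
    take. That number is at least 1, whence rounding up makes 2 into 3. *)
Lemma iteration_count : exists T : nat,
  T%:R <= 3 * (ln u^-1 / ln eps^-1) /\
  forall t, (T <= t)%N -> (c * eps) ^+ t <= u.
Proof.
have eps_gt0 : 0 < eps by apply: lt_le_trans u_le_eps.
have l_gt0 : 0 < ln eps^-1 by rewrite ln_gt0// invf_gt1.
pose ratio := ln u^-1 / ln eps^-1.
have ratio_ge1 : 1 <= ratio.
  by rewrite ler_pdivlMr// mul1r ler_ln ?posrE ?invr_gt0// lef_pV2 ?posrE.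
have ratio2_ge0 : 0 <= 2 * ratio by lra.
exists (Num.truncn (2 * ratio)).+1; split=> [|t Tt].
  have /andP[] := truncn_itv ratio2_ge0.
  by rewrite -natr1 -/ratio; move: ratio_ge1; lra.
have ratio_t : 2 * ratio <= t%:R.
  by apply: le_trans (ltW (truncnS_gt _)) _; rewrite ler_nat.
have ce_ge0 : 0 <= c * eps by rewrite mulr_ge0 ?ltW// (lt_le_trans ltr01).
rewrite -(@ler_pXn2r _ 2) ?nnegrE ?exprn_ge0 ?(ltW u_gt0)//.
(* [(c eps)^2t = (c^2 eps)^t eps^t <= eps^t <= u^2] *)
rewrite exprAC; apply: (@le_trans _ _ (eps ^+ t)).
  rewrite lerXn2r ?nnegrE ?exprn_ge0 ?(ltW eps_gt0)//.
  by rewrite exprMn [eps ^+ 2]expr2 mulrA ger_pMl.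
rewrite -ler_ln ?posrE ?exprn_gt0// !lnXn// -lerN2 -!mulNrn.
rewrite -!lnV ?posrE// -[leRHS]mulr_natl -[leLHS]mulr_natl.
by rewrite -ler_pdivrMr// -mulrA.
Qed.

End IterationCount.

Section PrefactorDominance.
Context {R : realType}.
Implicit Types (p q : {poly {poly R}}) (s : seq {poly {poly R}}).

Lemma prefactorM p q n u :
  prefactor (p * q) n u = prefactor p n u * prefactor q n u.
Proof. by rewrite /prefactor !hornerM. Qed.

Lemma prefactorX p k n u : prefactor (p ^+ k) n u = prefactor p n u ^+ k.
Proof. by rewrite /prefactor !horner_exp. Qed.

Lemma prefactorC (a : R) n u : prefactor a%:P%:P n u = a.
Proof. by rewrite /prefactor !hornerC. Qed.

(** Since [v <= 1 + v^2] for all real [v], summing [1 + p^2] gives a polynomial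
    above each [p] at every argument, whatever the signs of the coefficients. *)
Definition dominating s : {poly {poly R}} := \sum_(p <- s) (1 + p ^+ 2).

Lemma prefactor_dominating s n u :
  prefactor (dominating s) n u = \sum_(p <- s) (1 + prefactor p n u ^+ 2).
Proof.
rewrite /prefactor /dominating !horner_sum; apply: eq_bigr => p _.
by rewrite !hornerD !hornerC !horner_exp.
Qed.

Lemma dominatingP s p n u : p \in s ->
  1 <= prefactor (dominating s) n u /\
  prefactor p n u <= prefactor (dominating s) n u.
Proof.
move=> ps; rewrite prefactor_dominating (big_rem p)//=.
set v := prefactor p n u; set rest := \sum_(_ <- _) _.
have rest_ge0 : 0 <= rest.
  by apply: sumr_ge0 => q _; rewrite addr_ge0 ?sqr_ge0.
have := sqr_ge0 v; have := sqr_ge0 (v - 2^-1).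
by split; nra.
Qed.

End PrefactorDominance.

(** * Convergence of preconditioned iterative refinement *)

Theorem theorem6p2 (R : realType) :
  exists K : R, 0 < K /\
  forall (C a1 a2 : R) (pA pAT pP pPT pS : {poly {poly R}}),
  0 < a1 ->
  exists q pc pr pb : {poly {poly R}},
  forall (fp : fp_arith R) (n : nat) (A P : 'M[R]_n) (b : 'cV[R]_n)
    (ops : fl_operators R n) (IterativeSolver : subroutine R n),
  let u := roundoff fp in
  let kappa := cond A in
  let x := invmx A *m b in
  let xhat := iterate fp ops IterativeSolver b in
  (0 < n)%N ->
  A \in unitmx ->
  P \in unitmx ->
  muchless q n u (kappa * u) 1 ->
  cond (A *m invmx P) <= C ->
  a1 <= specnorm (A *m invmx P) <= a2 ->
  backward_stable_operators fp pA pAT pP pPT A P ops ->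
  exists (c : R) (T : nat),
    [/\ 0 <= c,
        lesssim pc n u c 1,
        T%:R <= K * (ln u^-1 / ln (kappa * u)^-1) &
        forall t : nat,
        (forall i, (i < t)%N ->
           solver_guarantee fp ops IterativeSolver b pS A P i) ->
        (forall i, (i <= t)%N ->
           lesssim pr n u (enorm (b - A *m xhat i))
             ((u + (c * kappa * u) ^+ i) * (specnorm A * enorm x))) /\
        ((T <= t)%N ->
         exists dA : 'M[R]_n, (A + dA) *m xhat t = b /\
           lesssim pb n u (specnorm dA) (u * specnorm A))].
Proof.
exists 3; split=> // C a1 a2 pA pAT pP pPT pS a1_gt0.
pose m := dominating [:: pA; pAT; pP; pPT; pS; a2%:P%:P; (C / a1)%:P%:P].
pose pc := 31%:P%:P * m ^+ 7.
exists (pc ^+ 2), pc, (26%:P%:P * m), (104%:P%:P * m).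
move=> fp n A P b ops IterativeSolver u kappa x xhat n_gt0 Aunit Punit.
rewrite /muchless prefactorX => q_small condW_le /andP[a1_le a2_le] stable.
have domP p := dominatingP
  [:: pA; pAT; pP; pPT; pS; a2%:P%:P; (C / a1)%:P%:P] p n u.
set M := prefactor m n u.
have [M_ge1 pA_le] : 1 <= M /\ prefactor pA n u <= M.
  by apply: domP; rewrite !inE eqxx.
have [_ pAT_le] : 1 <= M /\ prefactor pAT n u <= M.
  by apply: domP; rewrite !inE eqxx !orbT.
have [_ pP_le] : 1 <= M /\ prefactor pP n u <= M.
  by apply: domP; rewrite !inE eqxx !orbT.
have [_ pPT_le] : 1 <= M /\ prefactor pPT n u <= M.
  by apply: domP; rewrite !inE eqxx !orbT.
have [_ pS_le] : 1 <= M /\ prefactor pS n u <= M.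
  by apply: domP; rewrite !inE eqxx !orbT.
have [_ a2M] : 1 <= M /\ a2 <= M.
  by rewrite -(prefactorC a2 n u); apply: domP; rewrite !inE eqxx !orbT.
have [_ Ca1M] : 1 <= M /\ C / a1 <= M.
  by rewrite -(prefactorC (C / a1) n u); apply: domP; rewrite !inE eqxx !orbT.
have Wunit : A *m invmx P \in unitmx by rewrite unitmx_mul Aunit unitmx_inv.
have W_le : specnorm (A *m invmx P) <= M by exact: le_trans a2M.
have WV_le : specnorm (invmx (A *m invmx P)) <= M.
  apply: le_trans Ca1M; rewrite ler_pdivlMr// mulrC.
  apply: le_trans condW_le.
  apply: le_trans (specnorm_mul_inv_le_cond n_gt0 _ Wunit).
  by rewrite ler_wpM2r ?specnorm_ge0.
have pcE : prefactor pc n u = 31 * M ^+ 7.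
  by rewrite prefactorM prefactorC prefactorX.
set c : R := 31 * M ^+ 7.
rewrite pcE -/c in q_small.
have M_ge0 : 0 <= M by lra.
have M7_ge : M <= M ^+ 7 by rewrite -[leLHS]expr1 ler_weXn2l.
have u_gt0 : 0 < u := roundoff_gt0 fp.
have u_le_eps : u <= kappa * u := roundoff_le_eps n_gt0 Aunit.
have eps_gt0 : 0 < kappa * u by exact: lt_le_trans u_le_eps.
(* [c^2 eps <= 1] with [c = 31 M^7 >= 31] implies all the smallness conditions
   on [eps] that the lemmas need. *)
have c_ge31 : 31 * M <= c by rewrite /c; lra.
have c_sq : 31 * M * c <= c ^+ 2.
  by rewrite expr2 ler_wpM2r//; lra.
have c_le_sq : 31 * c <= c ^+ 2.
  by apply: le_trans c_sq; rewrite ler_wpM2r//; lra.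
have c_eps : 31 * c * (kappa * u) <= 1.
  by apply: le_trans q_small; rewrite ler_wpM2r// ltW.
have ceps_ge0 : 0 <= c * (kappa * u) by rewrite mulr_ge0 ?ltW//; lra.
have M_eps : M * (kappa * u) <= M ^+ 7 * (kappa * u).
  by rewrite ler_wpM2r// ltW.
have eps_M : kappa * u <= M * (kappa * u).
  by rewrite -[leLHS]mul1r ler_wpM2r// ltW.
have eps_lt1 : kappa * u < 1 by move: c_eps; rewrite /c; lra.
have c_ge1 : 1 <= c by lra.
have [T [T_le T_suff]] :=
  iteration_count _ _ _ u_gt0 u_le_eps eps_lt1 c_ge1 q_small.
exists c, T; split=> //; first by lra.
  by rewrite /lesssim pcE mulr1.
move=> t guar.
have rate_le : 2 * (31 * M ^+ 7 * (kappa * u)) <= 1.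
  by move: c_eps ceps_ge0; rewrite /c; lra.
have res := iterate_residual n_gt0 Aunit Punit stable M_ge1 pA_le pAT_le pP_le
  pPT_le pS_le W_le WV_le rate_le t guar.
have scale_ge0 : 0 <= specnorm A * enorm x.
  by rewrite mulr_ge0 ?specnorm_ge0 ?enorm_ge0.
have res_le i : (i <= t)%N -> enorm (b - A *m xhat i) <=
    26 * M * ((u + (c * (kappa * u)) ^+ i) * (specnorm A * enorm x)).
  move=> it; have [_ h] := res i it; apply: le_trans h _.
  rewrite -/c -/u -/kappa -/x; move: (exprn_ge0 i ceps_ge0).
  move: (_ ^+ i) => rate_i rate_i_ge0.
  have rate_scale_ge0 := mulr_ge0 rate_i_ge0 scale_ge0.
  by have := ler_wpM2r rate_scale_ge0 M_ge1; lra.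
split=> [i it|Tt].
  by rewrite /lesssim prefactorM prefactorC -/M -(mulrA c) res_le.
have [|||dA [dAE dA_le]] := backward_error_of_residual A b (xhat t) (52 * M * u)
  n_gt0 Aunit.
- by rewrite mulr_ge0 ?mulr_ge0 ?(ltW u_gt0).
- by move: c_eps; rewrite -/kappa /c; lra.
- apply: le_trans (res_le t (leqnn t)) _.
  have := ler_wpM2l M_ge0 (ler_wpM2r scale_ge0 (T_suff t Tt)).
  by rewrite -/x; lra.
exists dA; split=> //.
rewrite /lesssim prefactorM prefactorC -/M.
by apply: le_trans dA_le _; rewrite -/u; lra.
Qed.
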